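(* Let $\ell\ge 2$ be an integer. Then, for $a,b\gg1$, $$N_\ell(a)N_\ell(b) > N_\ell(a+b),$$ i.e. there exists $n_0$ (depending on $\ell$) such that this inequality holds for all integers $a,b\ge n_0$.
   Context: For positive integers $\ell,n$, let $S_n$ be the symmetric group on $n$ letters, let $C_{\ell,n} := \{(\pi_1,\dots,\pi_\ell)\in S_n^\ell : \pi_j\pi_k=\pi_k\pi_j \text{ for } 1\le j,k\le \ell\}$, and let $N_\ell(n) := |C_{\ell,n}|/|S_n|$. *)

(* Defs.v *)
From mathcomp Require Import all_boot all_order all_algebra all_fingroup.

Set Implicit Arguments.
Unset Strict Implicit.
Unset Printing Implicit Defensive.

Import GRing.Theory Num.Theory.

Definition commuting_tuples (l n : nat) : {set l.-tuple 'S_n} :=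
  [set t : l.-tuple 'S_n |
    [forall j : 'I_l, forall k : 'I_l,
      (tnth t j * tnth t k == tnth t k * tnth t j)%g]].

Definition N (l n : nat) : rat :=
  (#|commuting_tuples l n|%:R / #|{: 'S_n}|%:R)%R.

(* Main.v *)
Require Import Defs.
From mathcomp Require Import all_boot all_order all_algebra all_fingroup.
From mathcomp Require Import all_solvable.
From mathcomp Require Import ring lra zify.

(** Write p(n) for the number of commuting l-tuples of permutations of n points,
divided by n!.  Splitting a tuple at the orbit of a point (the tuple acts
transitively on the orbit and arbitrarily on its complement) gives the recursion
  n p(n) = sum_(j < n) s(n - j) p(j),   s(k) = k t(k) / k!,
with t(k) the number of transitive commuting l-tuples on k points
([ratio_recursion]).  So s(k) is the number of subgroups of index k of Z^l.  The
argument rests on two bounds: k <= s(k) when l >= 2, and s(k) is at most a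
polynomial in k.  The lower bound comes from pairs (c, c^i) with c
a k-cycle ([fact_le_ntrans]); the upper bound from the fact that a transitive
tuple is determined up to conjugation by the stabilizer of a point in (Z/k)^l,
a subgroup with at most l generators ([card_trans_le]).

The inequality then holds for every sequence satisfying such a recursion
([recursion_supermult]), without any asymptotic formula for p.
- As s(k) >= 1, p is nondecreasing; as s(k) >= k, p at least doubles along every
  step of length about 2 sqrt(n) ([doubling]), so that p(n - k) / p(n) is smaller
  than any power of 1/n as soon as k is a little larger than sqrt(n).
- Cut the recursion for p(a + b) at a:
    (a + b) p(a + b) = sum_(j < a) s(a + b - j) p(j)
                       + sum_(j < b) s(b - j) p(a + j).
  Bounding the first sum by a polynomial times p(a) and the second by induction
  on b yields p(a + b) <= (1 + b Q) p(a) p(b) with Q polynomial in a + b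
  ([supermult_weak]).
- Suppose p(a + j) <= C p(a) p(j) is known for all j <= b but those at distance
  more than M below b, where only the polynomial bound is known.  The sum of the
  s(b - j) p(j) over j < b is b p(b), and the terms with j < b - M are negligible
  if M is slightly larger than sqrt(b); hence the identity above gives
  p(a + b) <= (C b / (a + b) + small) p(a) p(b).  For b <= a the factor
  b / (a + b) is at most 1/2, so that each further distance M travelled halves
  the constant; after logarithmically many steps the polynomial loss is absorbed
  and the constant drops below 1 ([amplify]).
- For b > a the same identity propagates the strict inequality by induction on b
  ([strict_of_good_scale]). *)

Set Implicit Arguments.
Unset Strict Implicit.
Unset Printing Implicit Defensive.

Import Order.TTheory GRing.Theory Num.Theory.

(** * Supermultiplicativity from a recursion *)

Lemma leq_exp2rW d m n : (m <= n -> m ^ d <= n ^ d)%N.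
Proof. by case: d => // d; rewrite leq_exp2r. Qed.

Lemma sum_descending n : (2 * \sum_(i < n) (n - i) = n * n.+1)%N.
Proof.
elim: n => [|n IH]; first by rewrite big_ord0.
rewrite big_ord_recl subn0 mulnDr (eq_bigr (fun i : 'I_n => (n - i)%N)) ?IH; first lia.
by move=> i _; rewrite lift0 subSS.
Qed.

Section Recursion.
Local Open Scope ring_scope.
Variables (R : realFieldType) (s p : nat -> R) (D : nat).
Hypothesis p0 : p 0 = 1.
Hypothesis recp : forall n, n%:R * p n = \sum_(j < n) s (n - j) * p j.
Hypothesis s_ge : forall k, (0 < k)%N -> k%:R <= s k.
Hypothesis s_le : forall k, s k <= (k.+1 ^ D)%:R.

(** Bounds any sum of at most n values of s at arguments at most n. *)
Let Q n : R := (n * n.+1 ^ D)%:R.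

Lemma s_ge0 k : (0 < k)%N -> 0 <= s k.
Proof. by move=> k0; apply: le_trans (s_ge k0); rewrite ler0n. Qed.

(** The generating series of the increments of p is (1 - x) times that of p, and
this replaces s by s - 1 >= 0 in the recursion. *)
Lemma nondecr_step n : p n <= p n.+1.
Proof.
pose d n := if n is m.+1 then p m.+1 - p m else 1.
have sum_d m : \sum_(j < m.+1) d j = p m.
  elim: m => [|m IH]; first by rewrite big_ord_recr big_ord0 /= add0r p0.
  by rewrite big_ord_recr /= IH; ring.
have rec_d m : m.+1%:R * d m.+1 = \sum_(j < m.+1) (s (m.+1 - j) - 1) * d j.
  under eq_bigr => j _ do rewrite mulrBl mul1r.
  rewrite sumrB sum_d big_ord_recl /= subn0 mulr1.
  have E := recp m.+1; rewrite big_ord_recl /= subn0 p0 mulr1 in E.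
  under eq_bigr => j _ do rewrite /bump add1n subSS mulrBr.
  rewrite sumrB -recp; under [in RHS]eq_bigr => j _ do rewrite -[X in s X](subSS j m).
  rewrite [X in _ = s _ + (X - _) - _](_ : _ = m.+1%:R * p m.+1 - s m.+1).
    by rewrite /d -natr1; ring.
  by rewrite E addrAC subrr add0r; apply: eq_bigr.
have d_ge0 m : 0 <= d m.
  elim/ltn_ind: m => -[|m] IH; first exact: ler01.
  rewrite -(pmulr_rge0 _ (ltr0Sn R m)) rec_d; apply: sumr_ge0 => j _.
  apply: mulr_ge0; last exact: IH.
  rewrite subr_ge0; apply: le_trans (s_ge _); last by rewrite subn_gt0.
  by rewrite ler1n subn_gt0.
by rewrite -subr_ge0; exact: (d_ge0 n.+1).
Qed.

Lemma nondecr m n : (m <= n)%N -> p m <= p n.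
Proof.
by move/subnK <-; elim: (n - m)%N => // k IH; exact: le_trans IH (nondecr_step _).
Qed.

Lemma p_ge1 n : 1 <= p n.
Proof. by rewrite -p0 nondecr. Qed.

Lemma p_ge0 n : 0 <= p n. Proof. exact: le_trans ler01 (p_ge1 n). Qed.
Lemma p_gt0 n : 0 < p n. Proof. exact: lt_le_trans ltr01 (p_ge1 n). Qed.

(** The last 2 q terms of the recursion alone contribute at least
(1 + 2 + ... + 2 q) p(n), which is at least 2 (n + 2 q) p(n). *)
Lemma doubling q n : (0 < q)%N -> (n + 2 * q <= q ^ 2)%N -> 2 * p n <= p (n + 2 * q).
Proof.
move=> q0 hq; set m := (n + 2 * q)%N.
have m0 : (0 < m)%N by rewrite /m; lia.
rewrite -(ler_pM2l (x := m%:R)) ?ltr0n // recp.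
have -> : \sum_(j < m) s (m - j) * p j =
   \sum_(j < n) s (m - j) * p j + \sum_(i < 2 * q) s (m - (n + i)) * p (n + i)%N.
  by rewrite /m big_split_ord.
have h1 : 0 <= \sum_(j < n) s (m - j) * p j.
  apply: sumr_ge0 => j _; rewrite mulr_ge0 ?p_ge0 // s_ge0 // subn_gt0 /m.
  by rewrite ltn_addr.
have h2 : \sum_(i < 2 * q) (2 * q - i)%:R * p n <=
          \sum_(i < 2 * q) s (m - (n + i)) * p (n + i)%N.
  apply: ler_sum => i _; have := ltn_ord i => hi.
  have -> : (m - (n + i) = 2 * q - i)%N by rewrite /m; lia.
  by apply: ler_pM; rewrite ?ler0n ?p_ge0 ?s_ge ?nondecr ?subn_gt0 ?leq_addr.
have e : \sum_(i < 2 * q) (2 * q - i)%:R * p n = (q * (2 * q).+1)%:R * p n.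
  rewrite -mulr_suml -natr_sum; congr (_%:R * _).
  by apply/eqP; rewrite -(eqn_pmul2l (isT : 0 < 2)%N) sum_descending mulnA.
rewrite e in h2; apply: le_trans (le_trans h2 _); last by rewrite lerDr.
rewrite mulrA ler_wpM2r ?p_ge0 // -natrM ler_nat.
by move: hq; rewrite -/m; nia.
Qed.

Lemma doubling_iter q t n : (0 < q)%N -> (n + 2 * q * t <= q ^ 2)%N ->
  2 ^+ t * p n <= p (n + 2 * q * t).
Proof.
move=> q0; elim: t => [|t IH] h; first by rewrite muln0 addn0 expr0 mul1r.
have e : (n + 2 * q * t.+1 = n + 2 * q * t + 2 * q)%N by lia.
rewrite e in h *; apply: le_trans (doubling q0 h).
rewrite exprS -mulrA ler_pM2l ?ltr0n //; apply: IH; lia.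
Qed.

Lemma Q_ge0 n : 0 <= Q n. Proof. exact: ler0n. Qed.

Lemma Q_ge1 n : (0 < n)%N -> 1 <= Q n.
Proof. by move=> n0; rewrite ler1n muln_gt0 n0 expn_gt0. Qed.

Lemma head_le m a b (x : nat -> R) B : (a + b <= m)%N -> 0 <= B ->
    (forall j, (j < a)%N -> 0 <= x j <= B) ->
  \sum_(j < a) s (a + b - j) * x j <= Q m * B.
Proof.
move=> hm B0 hx.
have : \sum_(j < a) s (a + b - j) * x j <= \sum_(j < a) (m.+1 ^ D)%:R * B.
  apply: ler_sum => j _; have hj := ltn_ord j; have /andP[x0 xB] := hx j hj.
  apply: ler_pM => //; first by apply: s_ge0; lia.
  by apply: le_trans (s_le _) _; rewrite ler_nat leq_exp2rW //; lia.
move/le_trans; apply; rewrite sumr_const card_ord -mulrnAl -mulrnA mulnC.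
by rewrite ler_wpM2r // ler_nat leq_mul //; lia.
Qed.

(** In this cut of the recursion the second sum has the weights of the recursion
for p(b), so that estimates of p(a + j) / p(j) for j < b can be averaged. *)
Lemma rec_split m a b : (a + b <= m)%N ->
  (a + b)%:R * p (a + b) <= Q m * p a + \sum_(j < b) s (b - j) * p (a + j).
Proof.
move=> hm; rewrite recp big_split_ord /=; apply: lerD; last first.
  by apply: ler_sum => j _; rewrite subnDl.
apply: head_le => // [|j hj]; first exact: p_ge0.
by rewrite p_ge0 nondecr 1?ltnW.
Qed.

(** The averaging step: a crude constant A below c and a sharp one B above c cost
A only on p(c), which is much smaller than p(b) when c is well below b. *)
Lemma tail_le m a b c A B : (b <= m)%N -> (c <= b)%N -> 0 <= A -> 0 <= B ->
    (forall j, (j < c)%N -> p (a + j) <= A * (p a * p j)) ->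
    (forall j, (c <= j < b)%N -> p (a + j) <= B * (p a * p j)) ->
  \sum_(j < b) s (b - j) * p (a + j) <=
    Q m * (A * (p a * p c)) + B * (p a * (b%:R * p b)).
Proof.
move=> hm cb A0 B0 hA hB.
have [e bE] : exists e, b = (c + e)%N by exists (b - c)%N; lia.
rewrite {}bE in hm hB *; rewrite big_split_ord /=; apply: lerD.
  apply: (head_le (x := fun j => p (a + j))) => // [|j hj].
    by rewrite !mulr_ge0 ?p_ge0.
  rewrite p_ge0; apply: le_trans (hA j hj) _.
  by rewrite !ler_wpM2l ?p_ge0 ?nondecr 1?ltnW.
rewrite recp big_split_ord /= !mulrDr; apply: ler_wpDl.
  rewrite !mulr_ge0 ?p_ge0 //; apply: sumr_ge0 => j _.
  by have hj := ltn_ord j; rewrite mulr_ge0 ?p_ge0 ?s_ge0 //; lia.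
rewrite !mulr_sumr; apply: ler_sum => j _; have hj := ltn_ord j.
rewrite (mulrCA (p a)) (mulrCA B) ler_wpM2l ?s_ge0 //; first by lia.
by apply: hB; lia.
Qed.

(** Replacing a + b by b on the left-hand side of [rec_split] makes the induction
close; the first sum of the cut costs at most Q m p(a) at each step. *)
Lemma supermult_weak m a b : (a + b <= m)%N ->
  p (a + b) <= (1 + b%:R * Q m) * (p a * p b).
Proof.
elim/ltn_ind: b => -[|b] IH hm.
  by rewrite addn0 p0 mulr1 mul0r addr0 mul1r.
have Q0 := Q_ge0 m; have Na := p_ge0 a; have Nb := p_ge1 b.+1.
rewrite -(ler_pM2l (ltr0Sn R b)).
apply: (@le_trans _ _ ((a + b.+1)%:R * p (a + b.+1))).
  by rewrite ler_wpM2r ?p_ge0 // ler_nat leq_addl.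
apply: le_trans (rec_split hm) _.
have -> : b.+1%:R * ((1 + b.+1%:R * Q m) * (p a * p b.+1)) =
   b.+1%:R * Q m * p a * p b.+1 + (1 + b%:R * Q m) * p a * (b.+1%:R * p b.+1).
  by rewrite -[b.+1%:R]natr1; ring.
apply: lerD.
  rewrite -!mulrA -[leLHS]mul1r; apply: ler_pM; rewrite ?mulr_ge0 ?ler1n //.
  by rewrite ler_wpM2l // -[leLHS]mulr1 ler_wpM2l.
rewrite recp mulr_sumr; apply: ler_sum => j _; have hj := ltn_ord j.
have := IH j hj; rewrite (leq_trans _ hm) ?leq_add2l 1?ltnW // => /(_ isT) h.
rewrite mulrCA ler_wpM2l ?s_ge0 ?subn_gt0 //; apply: le_trans h _.
rewrite mulrA ler_wpM2r ?p_ge0 // ler_wpM2r // lerD2l ler_wpM2r //.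
by rewrite ler_nat -ltnS.
Qed.

(** Scales attached to b: p doubles along steps of length 2 q below b, r doublings
outweigh the polynomial losses for arguments up to 2 b, and r steps of length
2 q r fit in half of b. *)
Definition good_scale b q r :=
  [/\ (0 < q)%N, (0 < r)%N, (b <= q ^ 2)%N, (4 * q * r ^ 2 <= b)%N
    & 8 * (1 + b%:R * Q (2 * b)) * Q (2 * b) <= 2 ^+ r :> R].

(** The error term of [tail_le] is negligible for a cut at distance 2 q r. *)
Lemma good_scale_small a b q r h : good_scale a q r -> (b <= a)%N ->
    (2 * q * r <= b)%N -> (h <= b - 2 * q * r)%N ->
  8 * (Q (2 * a) * ((1 + a%:R * Q (2 * a)) * p h)) <= p b.
Proof.
move=> [q0 r0 haq hqr h8] ba hM hh.
have h2 : 2 ^+ r * p (b - 2 * q * r) <= p b.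
  by have := @doubling_iter q r (b - 2 * q * r) q0; rewrite subnK //; apply; lia.
apply: le_trans h2.
apply: (@le_trans _ _ (2 ^+ r * p h)); last by rewrite ler_wpM2l ?exprn_ge0 ?nondecr.
by rewrite !mulrA ler_wpM2r ?p_ge0 //; apply: le_trans h8; lra.
Qed.

Lemma supermult_weak_scale a c j : (a + j <= 2 * c)%N -> (j <= c)%N ->
  p (a + j) <= (1 + c%:R * Q (2 * c)) * (p a * p j).
Proof.
move=> h jc; apply: le_trans (supermult_weak h) _.
by rewrite ler_wpM2r ?mulr_ge0 ?p_ge0 // lerD2l ler_wpM2r ?Q_ge0 // ler_nat.
Qed.

Lemma Q_error a h A : 1 <= A -> forall m, Q m * p a <= Q m * (A * (p a * p h)).
Proof.
move=> A1 m; rewrite ler_wpM2l ?Q_ge0 // mulrCA -[leLHS]mulr1 ler_wpM2l ?p_ge0 //.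
by rewrite -[leLHS]mul1r; apply: ler_pM; rewrite ?ler01 ?p_ge1.
Qed.

(** Each step of length 2 q r replaces a constant C by (C + 1/4) / 2: the factor
1/2 is b / (a + b) <= 1/2, and 1/4 accounts for the negligible terms. *)
Lemma amplify a q r t b : good_scale a q r -> (b <= a)%N -> (2 * q * r * t <= b)%N ->
  p (a + b) <= (1 / 4 + (1 + a%:R * Q (2 * a)) / 2 ^+ t) * (p a * p b).
Proof.
move=> ga; have [q0 r0 haq hqr _] := ga.
set A := 1 + _; have Q0 := Q_ge0 (2 * a).
have A1 : 1 <= A by rewrite lerDl mulr_ge0 ?ler0n.
have A0 := le_trans ler01 A1.
elim: t b => [|t IH] b hba ht.
  have hm : (a + b <= 2 * a)%N by lia.
  apply: le_trans (supermult_weak_scale hm hba) _.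
  rewrite ler_wpM2r ?mulr_ge0 ?p_ge0 //.
  by rewrite expr0 divr1 lerDr divr_ge0 ?ler0n.
have -> : 1 / 4 + A / 2 ^+ t.+1 = (1 / 4 + A / 2 ^+ t + 1 / 4) / 2.
  have : 2 ^+ t != 0 :> R by rewrite expf_neq0 ?pnatr_eq0.
  by rewrite exprS => ?; field.
set C := _ + A / 2 ^+ t in IH *.
have C0 : 0 <= C by rewrite addr_ge0 ?divr_ge0 ?exprn_ge0 ?ler0n.
pose M := (2 * q * r)%N.
have M0 : (0 < M)%N by rewrite /M; nia.
have hM : (M * t + M <= b)%N by move: ht; rewrite /M; lia.
have b0 : (0 < b)%N by lia.
have hm : (a + b <= 2 * a)%N by lia.
have hsum : \sum_(j < b) s (b - j) * p (a + j) <=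
    Q (2 * a) * (A * (p a * p (b - M))) + C * (p a * (b%:R * p b)).
  apply: tail_le; rewrite ?leq_subr //; first by lia.
    by move=> j hj; apply: supermult_weak_scale; lia.
  by move=> j hj; apply: IH; rewrite -?/M; lia.
have small : 8 * (Q (2 * a) * (A * p (b - M))) <= p b.
  by apply: good_scale_small ga hba _ _; rewrite -/M //; lia.
rewrite -(ler_pM2l (_ : 0 < (2 * b)%:R :> R)) ?ltr0n; last by lia.
apply: (@le_trans _ _ ((a + b)%:R * p (a + b))).
  by rewrite ler_wpM2r ?p_ge0 // ler_nat; lia.
apply: le_trans (rec_split hm) _.
apply: le_trans (lerD (Q_error a (b - M) A1 _) hsum) _.
have e1 : p a * (8 * (Q (2 * a) * (A * p (b - M)))) <= p a * (b%:R * p b).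
  rewrite ler_wpM2l ?p_ge0 //; apply: le_trans small _.
  by rewrite -[leLHS]mul1r ler_wpM2r ?p_ge0 // ler1n.
have -> : (2 * b)%:R * ((C + 1 / 4) / 2 * (p a * p b)) =
   C * (p a * (b%:R * p b)) + 1 / 4 * (p a * (b%:R * p b)).
  by rewrite natrM; field.
lra.
Qed.

(** For b <= a this is [amplify] after r steps.  For b > a, split the recursion at
h = 2 q r^2: the strict inequality holds inductively for h <= j < b, and the
terms with j < h are negligible since h <= a / 2 < b / 2; the gain comes from
a + b on the left-hand side against b on the right-hand side. *)
Lemma strict_of_good_scale a q r b : good_scale a q r ->
    (forall c, (a < c)%N -> exists q' r', good_scale c q' r') ->
  (2 * q * r ^ 2 <= b)%N -> p (a + b) < p a * p b.
Proof.
move=> ga gc; have [q0 r0 haq hqr h8] := ga; set h := (2 * q * r ^ 2)%N.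
have a0 : (0 < a)%N by nia.
have ha : (2 * h <= a)%N by rewrite /h; lia.
elim/ltn_ind: b => b IH hb.
have NN : 0 < p a * p b by rewrite mulr_gt0 ?p_gt0.
have [ba|ab] := leqP b a.
  have hb' : (2 * q * r * r <= b)%N by move: hb; rewrite /h; lia.
  apply: le_lt_trans (amplify ga ba hb') _.
  rewrite -[ltRHS]mul1r ltr_pM2r //.
  have r2 : 0 < 2 ^+ r :> R by rewrite exprn_gt0.
  suff : (1 + a%:R * Q (2 * a)) / 2 ^+ r <= 1 / 8 by lra.
  rewrite ler_pdivrMr //.
  have Q1 : 1 <= Q (2 * a) by apply: Q_ge1; lia.
  have A0 : 0 <= 1 + a%:R * Q (2 * a) by rewrite addr_ge0 ?mulr_ge0 ?ler0n.
  have : 1 + a%:R * Q (2 * a) <= (1 + a%:R * Q (2 * a)) * Q (2 * a).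
    by rewrite -[leLHS]mulr1 ler_wpM2l.
  lra.
have [q' [r' gb]] := gc b ab; have [q0' r0' _ hqr' _] := gb.
set A := 1 + b%:R * Q (2 * b).
have Q0 := Q_ge0 (2 * b).
have A1 : 1 <= A by rewrite lerDl mulr_ge0 ?ler0n.
have Nh : 8 * (Q (2 * b) * (A * p h)) <= p b.
  by apply: good_scale_small gb (leqnn b) _ _; nia.
have hm : (a + b <= 2 * b)%N by lia.
have S1 : \sum_(j < b) s (b - j) * p (a + j) <=
    Q (2 * b) * (A * (p a * p h)) + 1 * (p a * (b%:R * p b)).
  apply: tail_le => //; first by lia.
  - exact: le_trans ler01 A1.
  - by move=> j hj; apply: supermult_weak_scale; lia.
  by move=> j /andP[hj jb]; rewrite mul1r; apply/ltW/IH.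
have ab0 : 0 < (a + b)%:R :> R by rewrite ltr0n; lia.
rewrite -(ltr_pM2l ab0); apply: le_lt_trans (rec_split hm) _.
apply: le_lt_trans (lerD (Q_error a h A1 _) S1) _.
have e1 : p a * (8 * (Q (2 * b) * (A * p h))) <= p a * p b by rewrite ler_wpM2l ?p_ge0.
have e2 : p a * p b <= a%:R * (p a * p b).
  by rewrite -[leLHS]mul1r ler_wpM2r ?ler1n // ltW.
rewrite natrD; lra.
Qed.

(** With u = log2 b, take q = 2 ^ (u / 2 + 1), of the order of sqrt(b), and r
proportional to u, so that 2 ^ r exceeds the given power of b. *)
Lemma good_scale_eventually :
  exists n0, forall b, (n0 <= b)%N -> exists q r, good_scale b q r.
Proof.
(* With X = 2 ^ (u + 2) the quantity to be exceeded is at most X ^ E, and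
   2312 = 8 * 17 ^ 2 is the constant met when 4 q r ^ 2 is compared with b. *)
pose E := (2 * D + 5)%N; pose K := (2312 * E ^ 2)%N.
exists (2 ^ (8 * K + 8))%N => b hb.
have b0 : (0 < b)%N by apply: leq_trans hb; rewrite expn_gt0.
have /andP[lb ub] := trunc_log_bounds (isT : 1 < 2)%N b0.
set u := trunc_log 2 b in lb ub.
have hu : (8 * K + 8 <= u)%N by rewrite trunc_log_max.
exists (2 ^ (u + 2)./2)%N, ((u + 2) * E)%N; split.
- by rewrite expn_gt0.
- by rewrite muln_gt0 addn2 /E addnS.
- apply: leq_trans (ltnW ub) _; rewrite -expnM leq_exp2l //; lia.
- apply: leq_trans lb.
  set w := u./2; set v := (w %/ 4)%N.
  have huw : (u <= 2 * w + 1)%N by rewrite /w; lia.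
  have hwu : (2 * w <= u)%N by rewrite /w; lia.
  have -> : (u + 2)./2 = w.+1 by rewrite /w addn2.
  have hvw : (4 * v <= w)%N by rewrite /v; lia.
  have hwv : (w <= 4 * v + 3)%N by rewrite /v; lia.
  have Kv : (K < v)%N by lia.
  have v2 := ltn_expl v (isT : 1 < 2)%N.
  have h1 : ((u + 2) * E <= 17 * v * E)%N by rewrite leq_mul2r; apply/orP; right; lia.
  have h2 : (((u + 2) * E) ^ 2 <= 289 * v ^ 2 * E ^ 2)%N.
    by apply: leq_trans (leq_exp2rW 2 h1) _; rewrite !expnMn leqnn.
  have h3 : (8 * (289 * v ^ 2 * E ^ 2) <= v ^ 3)%N.
    have -> : (8 * (289 * v ^ 2 * E ^ 2) = K * v ^ 2)%N by rewrite /K; ring.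
    by rewrite (expnS v 2) leq_mul2r ltnW ?orbT.
  have h4 : (v ^ 3 <= 2 ^ w)%N.
    apply: leq_trans (leq_exp2rW 3 (ltnW v2)) _; rewrite -expnM leq_exp2l //; lia.
  apply: (@leq_trans (2 ^ (2 * w))); last by rewrite leq_exp2l.
  rewrite mul2n -addnn expnD expnS.
  have h5 := leq_trans (leq_trans (leq_mul (leqnn 8) h2) h3) h4.
  by apply: leq_trans (leq_mul (leqnn (2 ^ w)) h5); lia.
- set X := (2 ^ (u + 2))%N.
  have bX : ((2 * b).+1 <= X)%N by rewrite /X addn2 expnS; lia.
  have X8 : (8 <= X)%N by rewrite (@leq_exp2l 2 3) //; lia.
  rewrite -natrX expnM -/X /Q -natrM -[1]/(1%:R) -natrD -!natrM ler_nat.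
  set q := (2 * b * _)%N.
  have q1 : (0 < q)%N by rewrite /q muln_gt0 expn_gt0; lia.
  have qX : (q <= X ^ D.+1)%N by rewrite expnS leq_mul ?leq_exp2rW // ltnW.
  have -> : E = (1 + (1 + D.+1) + D.+1 + 1)%N by rewrite /E; lia.
  rewrite !expnD !expn1 -[X in (X <= _)%N]muln1.
  by rewrite !leq_mul //; nia.
Qed.

Theorem recursion_supermult : exists n0, forall a b, (n0 <= a)%N -> (n0 <= b)%N ->
  p (a + b) < p a * p b.
Proof.
have [n0 hn] := good_scale_eventually; exists n0.
suff H a b : (n0 <= a <= b)%N -> p (a + b) < p a * p b.
  move=> a b ha hb; have [ab|/ltnW ba] := leqP a b; first by apply: H; rewrite ha.
  by rewrite addnC mulrC; apply: H; rewrite hb.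
case/andP=> ha ab; have [q [r ga]] := hn a ha.
apply: (strict_of_good_scale ga) => [c ac|]; first by apply: hn; lia.
by case: ga => _ _ _ h _; lia.
Qed.
End Recursion.

(** * Commuting tuples and the orbit of a point *)

Section Tuples.
Local Open Scope group_scope.
Variables (l : nat) (T : finType).
Implicit Types (f : {ffun 'I_l -> {perm T}}) (x y : T) (A : {set T}).

Definition comm_maps : {set {ffun 'I_l -> {perm T}}} :=
  [set f : {ffun _ -> {perm T}} | [forall i, forall j, f i * f j == f j * f i]].

Lemma comm_mapsP f : reflect (forall i j, commute (f i) (f j)) (f \in comm_maps).
Proof.
rewrite inE; apply: (iffP forallP) => [h i j|h i]; first by have /forallP/(_ j)/eqP := h i.
by apply/forallP => j; apply/eqP/h.
Qed.

Definition gen f : {group {perm T}} := <<[set f i | i : 'I_l]>>%G.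
Definition orb f x := orbit 'P (gen f) x.
Definition trans_maps := [set f in comm_maps | [forall x, orb f x == setT]].

Lemma gen_mem f i : f i \in gen f.
Proof. by apply/mem_gen/imsetP; exists i. Qed.

Lemma orb_refl f x : x \in orb f x. Proof. exact: orbit_refl. Qed.

Lemma orb_step f x y i : y \in orb f x -> f i y \in orb f x.
Proof. exact/orbit_trans/(mem_orbit 'P y (gen_mem f i)). Qed.

(** Stability under the f i suffices, without their inverses, by finiteness. *)
Lemma orb_min f x A : x \in A -> (forall i y, y \in A -> f i y \in A) -> orb f x \subset A.
Proof.
move=> xA hA; rewrite acts_sub_orbit // gen_subG.
apply/subsetP => _ /imsetP[i _ ->]; rewrite inE in_setT /=; rewrite !inE.
by apply/subsetP => y yA; rewrite inE; apply: hA.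
Qed.

Lemma orb_eq f x y : y \in orb f x -> orb f y = orb f x.
Proof. by move=> h; apply/orbit_eqP. Qed.

Lemma orb_stepE f x y i : (f i y \in orb f x) = (y \in orb f x).
Proof.
apply/idP/idP => [h|]; last exact: orb_step.
apply: orbit_trans h; rewrite orbit_sym; exact: (mem_orbit 'P y (gen_mem f i)).
Qed.

Lemma trans_mapsP f x : reflect (f \in comm_maps /\ orb f x = setT) (f \in trans_maps).
Proof.
rewrite [X in reflect _ X]in_set; apply: (iffP andP) => -[fc].
  by move/forallP => /(_ x)/eqP.
move=> h; split=> //; apply/forallP => y; rewrite (@orb_eq f x) ?h ?inE //.
Qed.
End Tuples.

(** * Gluing tuples along a partition of the points *)

(** A partition of T in two blocks is given by a bijection from a sum type, so that
both blocks are types and permutations of a block need no support condition. *)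
Section Glue.
Local Open Scope group_scope.
Variables (l : nat) (T U V : finType) (beta : U + V -> T) (beta' : T -> U + V).
Hypotheses (betaK : cancel beta beta') (beta'K : cancel beta' beta).

Definition sum_fun (p : U -> U) (q : V -> V) (z : U + V) : U + V :=
  match z with inl u => inl (p u) | inr v => inr (q v) end.
Lemma glue_inj (p : {perm U}) (q : {perm V}) : injective (beta \o sum_fun p q \o beta').
Proof.
apply: inj_comp; last exact: can_inj beta'K.
apply: inj_comp; first exact: can_inj betaK.
by move=> [u|v] [u'|v'] //= [] /perm_inj ->.
Qed.
Definition glue p q : {perm T} := perm (@glue_inj p q).

Lemma glue_inl p q u : glue p q (beta (inl u)) = beta (inl (p u)).
Proof. by rewrite permE /= betaK. Qed.
Lemma glue_inr p q v : glue p q (beta (inr v)) = beta (inr (q v)).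
Proof. by rewrite permE /= betaK. Qed.

Lemma beta_ind (P : T -> Prop) :
  (forall u, P (beta (inl u))) -> (forall v, P (beta (inr v))) -> forall x, P x.
Proof. by move=> hu hv x; rewrite -(beta'K x); case: (beta' x). Qed.

Lemma glueM p q p' q' : glue p q * glue p' q' = glue (p * p') (q * q').
Proof.
by apply/permP; apply: beta_ind => [u|v]; rewrite permM ?glue_inl ?glue_inr permM.
Qed.

Lemma glue_eq p q p' q' : glue p q = glue p' q' -> p = p' /\ q = q'.
Proof.
move/permP=> h; split; apply/permP => z.
  by have := h (beta (inl z)); rewrite !glue_inl => /(can_inj betaK)[].
by have := h (beta (inr z)); rewrite !glue_inr => /(can_inj betaK)[].
Qed.

Definition glue_left := [set beta (inl u) | u : U].
Lemma mem_glue_left_inl u : beta (inl u) \in glue_left. Proof. by apply/imsetP; exists u. Qed.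
Lemma mem_glue_left_inr v : (beta (inr v) \in glue_left) = false.
Proof. by apply/imsetP => -[u _ /(can_inj betaK)]. Qed.

Lemma glue_surj (g : {perm T}) : (forall x, (g x \in glue_left) = (x \in glue_left)) ->
  exists p q, g = glue p q.
Proof.
move=> hg.
have hU u : exists u', g (beta (inl u)) == beta (inl u').
  by have := mem_glue_left_inl u; rewrite -hg => /imsetP[u' _ ->]; exists u'.
have hV v : exists v', g (beta (inr v)) == beta (inr v').
  have := mem_glue_left_inr v; rewrite -hg; move: (g _); apply: beta_ind => [u|v' _].
    by rewrite mem_glue_left_inl.
  by exists v'.
pose pu u := xchoose (hU u); pose qv v := xchoose (hV v).
have pE u : g (beta (inl u)) = beta (inl (pu u)) by apply/eqP/(xchooseP (hU u)).
have qE v : g (beta (inr v)) = beta (inr (qv v)) by apply/eqP/(xchooseP (hV v)).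
have pI : injective pu.
  by move=> u u' e; have := pE u; rewrite e -pE => /perm_inj/(can_inj betaK)[].
have qI : injective qv.
  by move=> u u' e; have := qE u; rewrite e -qE => /perm_inj/(can_inj betaK)[].
exists (perm pI), (perm qI); apply/permP; apply: beta_ind => [u|v].
  by rewrite glue_inl permE.
by rewrite glue_inr permE.
Qed.

Definition glue_maps (gh : {ffun 'I_l -> {perm U}} * {ffun 'I_l -> {perm V}}) :
  {ffun 'I_l -> {perm T}} := [ffun i => glue (gh.1 i) (gh.2 i)].

Lemma glue_maps_inj : injective glue_maps.
Proof.
move=> [g h] [g' h'] /ffunP e; congr (_, _); apply/ffunP => i;
by have := e i; rewrite !ffunE => /glue_eq[].
Qed.

Lemma glue_maps_comm g h : (glue_maps (g, h) \in comm_maps l T) =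
  (g \in comm_maps l U) && (h \in comm_maps l V).
Proof.
apply/comm_mapsP/andP => [H|[/comm_mapsP G /comm_mapsP H] i j]; last first.
  by rewrite /commute !ffunE !glueM G H.
split; apply/comm_mapsP => i j; have := H i j; rewrite /commute !ffunE !glueM;
by case/glue_eq.
Qed.

Lemma orb_glue g h u :
  orb (glue_maps (g, h)) (beta (inl u)) = [set beta (inl u') | u' in orb g u].
Proof.
apply/eqP; rewrite eqEsubset; apply/andP; split.
  apply: orb_min => [|i _ /imsetP[u' hu' ->]]; first exact/imset_f/orb_refl.
  by rewrite ffunE glue_inl; apply/imset_f/orb_step.
apply/subsetP => _ /imsetP[u' hu' ->].
pose A := [set u' | beta (inl u') \in orb (glue_maps (g, h)) (beta (inl u))].
suff /subsetP/(_ u' hu') : orb g u \subset A by rewrite inE.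
apply: orb_min => [|i y]; first by rewrite inE orb_refl.
rewrite !inE => /(orb_step i); by rewrite ffunE glue_inl.
Qed.

(** A tuple whose orbit of a point is a given block is glued from a transitive
tuple on the block and any commuting tuple on the other block. *)
Lemma card_orb_eq u :
  #|[set f in comm_maps l T | orb f (beta (inl u)) == glue_left]| =
  (#|trans_maps l U| * #|comm_maps l V|)%N.
Proof.
rewrite -cardsX -(card_imset _ glue_maps_inj); congr #|pred_of_set _|; apply/setP => f.
apply/idP/imsetP => [|[[g h] /setXP[/= /(trans_mapsP _ u)[gc og] hc] ->]]; last first.
  rewrite inE glue_maps_comm gc hc orb_glue og; apply/eqP/setP => x.
  by apply/imsetP/imsetP => -[u' _ ->]; exists u'.
rewrite inE => /andP[fc /eqP oB].
have H i : exists pq, f i == glue pq.1 pq.2.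
  have [x|p [q e]] := @glue_surj (f i); first by rewrite -oB orb_stepE.
  by exists (p, q); apply/eqP.
pose G i := xchoose (H i).
have fE : f = glue_maps ([ffun i => (G i).1], [ffun i => (G i).2]).
  by apply/ffunP => i; rewrite !ffunE /=; apply/eqP/(xchooseP (H i)).
exists ([ffun i => (G i).1], [ffun i => (G i).2]) => //.
move: oB fc; rewrite fE glue_maps_comm orb_glue => oB /andP[gc hc].
rewrite inE hc andbT; apply/(trans_mapsP _ u); split=> //.
apply/setP => u'; rewrite inE; have := mem_glue_left_inl u'; rewrite -oB.
by case/imsetP => u'' ? /(can_inj betaK)[->].
Qed.
End Glue.

(** * The recursion *)

Section Count.
Variable l : nat.
Definition ncomm n := #|comm_maps l 'I_n|.
Definition ntrans n := #|trans_maps l 'I_n|.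

Lemma card_orb_eqA (T : finType) (A : {set T}) x : x \in A ->
  #|[set f in comm_maps l T | orb f x == A]| = (ntrans #|A| * ncomm (#|~: A|))%N.
Proof.
move=> xA.
pose beta (z : 'I_#|A| + 'I_#|~: A|) : T :=
  match z with inl i => enum_val i | inr i => enum_val i end.
have beta_inj : injective beta.
  move=> [i|i] [j|j] /= e.
  - by rewrite (enum_val_inj e).
  - by have := enum_valP j; rewrite -e inE enum_valP.
  - by have := enum_valP i; rewrite e inE enum_valP.
  - by rewrite (enum_val_inj e).
have [|beta' bK bK'] := inj_card_bij beta_inj.
  by rewrite card_sum !card_ord cardsC.
rewrite /ntrans /ncomm -(card_orb_eq l bK bK' (enum_rank_in xA x)) /= enum_rankK_in //.
congr #|pred_of_set _|; apply/setP => f; rewrite !inE; congr (_ && (_ == _)).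
apply/setP => y; apply/idP/imsetP => [yA|[i _ ->]]; last exact: enum_valP.
by exists (enum_rank_in xA y) => //=; rewrite enum_rankK_in.
Qed.

(** Double counting of the pairs (tuple, point): summing over all points x, and
over the orbit of x, makes each set of k points count k times. *)
Lemma ncomm_recursion n :
  (n * ncomm n = \sum_(k < n.+1) 'C(n, k) * (k * ntrans k * ncomm (n - k)))%N.
Proof.
transitivity (\sum_(x : 'I_n) \sum_(A : {set 'I_n} | x \in A) ntrans #|A| * ncomm (n - #|A|))%N.
  rewrite -{1}(card_ord n) -sum_nat_const; apply: eq_bigr => x _.
  rewrite /ncomm -sum1_card (partition_big (fun f => orb f x) (fun A => x \in A)) /=; last first.
    by move=> f _; apply: orb_refl.
  apply: eq_bigr => A xA; rewrite sum1_card.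
  have := card_orb_eqA xA; rewrite [#|~: A|]cardsCs setCK card_ord => <-.
  by apply: eq_card => f; rewrite [RHS]in_set.
rewrite (exchange_big_dep xpredT) //=.
under eq_bigr => A _ do rewrite sum_nat_const.
rewrite (partition_big (fun A : {set 'I_n} => inord #|A| : 'I_n.+1) xpredT) //=.
have cardA (A : {set 'I_n}) : (#|A| < n.+1)%N by have := max_card (mem A); rewrite card_ord.
apply: eq_bigr => k _; have := card_draws 'I_n k; rewrite card_ord => <-; rewrite -sum_nat_const.
apply: eq_big => [A|A]; first by rewrite inE -val_eqE /= inordK.
by rewrite -val_eqE /= inordK // => /eqP ->; rewrite mulnA.
Qed.

Local Open Scope ring_scope.
Definition comm_ratio n : rat := (ncomm n)%:R / n`!%:R.
(** The number of subgroups of index k of Z^l. *)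
Definition trans_weight k : rat := (k * ntrans k)%:R / k`!%:R.

Lemma ratio_recursion n : n%:R * comm_ratio n = \sum_(j < n) trans_weight (n - j) * comm_ratio j.
Proof.
have fz m : m`!%:R != 0 :> rat by rewrite pnatr_eq0 -lt0n fact_gt0.
transitivity (\sum_(j < n.+1) trans_weight (n - j) * comm_ratio j); last first.
  by rewrite big_ord_recr /= subnn /trans_weight mul0n !mul0r addr0.
rewrite /comm_ratio mulrA -natrM ncomm_recursion natr_sum mulr_suml (reindex_inj rev_ord_inj).
apply: eq_bigr => j _ /=; have hj : (j <= n)%N by rewrite -ltnS.
rewrite subSS subKn // /trans_weight -(bin_fact hj) bin_sub // !natrM.
have b0 : ('C(n, j))%:R != 0 :> rat by rewrite pnatr_eq0 -lt0n bin_gt0.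
by field; rewrite !fz b0.
Qed.

Lemma comm_ratio0 : comm_ratio 0 = 1.
Proof.
rewrite /comm_ratio fact0 divr1 /ncomm; have -> // : #|comm_maps l 'I_0| = 1%N.
apply/eqP/cards1P; exists [ffun => 1%g]; apply/setP => f; rewrite [RHS]in_set1.
have triv (p q : {perm 'I_0}) : p = q by apply/permP => -[].
have -> : f = [ffun => 1%g] by apply/ffunP => i; apply: triv.
by rewrite eqxx; apply/comm_mapsP => i j; apply: triv.
Qed.
End Count.

(** * Counting transitive commuting tuples *)

Section Lower.
Local Open Scope group_scope.
Variables (l m : nat).
Definition cyc : {perm 'I_m.+1} := perm (can_inj (@ordSK m.+1)).

Lemma cycX n (x : 'I_m.+1) : (cyc ^+ n) x = (x + n) %% m.+1 :> nat.
Proof.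
rewrite permX; elim: n => [|n IH]; first by rewrite addn0 modn_small.
by rewrite iterS permE /= IH addnS -addn1 modnDml addn1.
Qed.

Lemma cycX0 (x : 'I_m.+1) : (cyc ^+ x) ord0 = x.
Proof. by apply: val_inj; rewrite /= cycX add0n modn_small. Qed.

(** Encodes the permutation s in two commuting permutations: the conjugate of the
standard cycle determines s up to the image of 0, which is stored in the exponent
of the second entry. *)
Definition cyc_maps (s : {perm 'I_m.+1}) : {ffun 'I_l -> {perm 'I_m.+1}} :=
  [ffun i : 'I_l => (cyc ^ s) ^+ (match val i with 0 => 1 | 1 => s ord0 : nat | _ => 0 end)%N].

Lemma cyc_maps_inj : 2 <= l -> injective cyc_maps.
Proof.
move=> l2 s s' /ffunP e.
have e0 : cyc ^ s = cyc ^ s' by have := e (Ordinal (ltnW l2)); rewrite !ffunE /= !expg1.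
have := e (Ordinal l2); rewrite !ffunE /= -e0 -!conjXg.
move/permP/(_ (s ord0)); rewrite !permJ => /perm_inj; rewrite !cycX0 => e1.
apply/permP => x.
by rewrite -(cycX0 x) -[LHS]permJ -[RHS]permJ !conjXg -e0 e1.
Qed.

Lemma cyc_maps_trans s : 0 < l -> cyc_maps s \in trans_maps l 'I_m.+1.
Proof.
move=> l0; apply/(trans_mapsP _ (s ord0)); split.
  by apply/comm_mapsP => i j; rewrite !ffunE; apply/commuteX2.
apply/setP => y; rewrite in_setT -(permKV s y) -(cycX0 (s^-1 y)) -permJ conjXg.
have := gen_mem (cyc_maps s) (Ordinal l0); rewrite ffunE expg1 => h.
exact: (mem_orbit 'P _ (groupX _ h)).
Qed.

Lemma fact_le_ntrans : 2 <= l -> (m.+1)`! <= ntrans l m.+1.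
Proof.
move=> l2; have <- : #|[set: {perm 'I_m.+1}]| = (m.+1)`!.
  by rewrite cardsT card_Sn.
rewrite /ntrans -(card_imset _ (cyc_maps_inj l2)); apply: subset_leq_card.
by apply/subsetP => _ /imsetP[s _ ->]; apply: cyc_maps_trans; apply: ltnW.
Qed.
End Lower.

Section Upper.
Local Open Scope group_scope.
Variables (l : nat) (T : finType) (x0 : T).
Local Notation k := #|T|.
Local Notation V := 'rV['Z_k]_l.
Implicit Types (f : {ffun 'I_l -> {perm T}}) (u v : V).

(** A transitive abelian group is regular, hence of order k.  The exponent below is
k for k > 1 (and 2 for k = 1), which makes words with exponents in 'Z_k
well-behaved. *)
Lemma trans_expg f i : f \in trans_maps l T -> f i ^+ (Zp_trunc k).+2 = 1.
Proof.
case/(trans_mapsP _ x0) => /comm_mapsP fc fT.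
have ab : abelian (gen f).
  rewrite abelian_gen; apply/centsP => _ /imsetP[a _ ->] _ /imsetP[b _ ->]; exact: fc.
have stab1 : 'C_(gen f)[x0 | 'P] = 1.
  apply/trivgP/subsetP => g /setIP[gf]; rewrite !inE /= => /subsetP/(_ x0).
  rewrite !inE eqxx => /(_ isT)/eqP gx0; apply/eqP/permP => y.
  have : y \in orb f x0 by rewrite fT.
  case/imsetP => h hf ->; rewrite perm1 /= /aperm -permM.
  by rewrite (centsP ab _ hf _ gf) permM; congr (fun_of_perm h _); exact: gx0.
have cG : #|gen f| = k.
  by rewrite -(card_orbit_stab 'P _ x0) stab1 cards1 muln1 -cardsT -fT.
have k0 : 0 < k by apply/card_gt0P; exists x0.
have [k1|] := ltnP 1 k.
  by rewrite Zp_cast // -cG expg_cardG ?gen_mem.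
move=> k1; have := gen_mem f i.
have /eqP : #|gen f| = 1%N by rewrite cG; lia.
by rewrite -trivg_card1 => /eqP ->; move/set1P ->; rewrite expg1n.
Qed.

Definition word f v : {perm T} := \prod_(i < l) f i ^+ (v ord0 i : nat).

Section Fixed.
Variable f : {ffun 'I_l -> {perm T}}.
Hypothesis ft : f \in trans_maps l T.
Let fc i j : commute (f i) (f j).
Proof. by move: ft => /(trans_mapsP _ x0)[/comm_mapsP h _]. Qed.

Lemma wordD u v : word f (u + v)%R = word f u * word f v.
Proof.
rewrite -prodgM_commute => [|i j _ _]; last exact/commuteX2.
apply: eq_bigr => i _; rewrite mxE -expgD /=.
exact/expg_mod/trans_expg.
Qed.

Lemma word0 : word f 0%R = 1.
Proof. by rewrite /word big1 // => i _; rewrite mxE. Qed.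

Lemma word_delta i : word f (delta_mx 0 i)%R = f i.
Proof.
rewrite /word (big_only1 i) // => [|j ji _]; first by rewrite mxE !eqxx expg1.
by rewrite mxE (negbTE ji) andbF.
Qed.

Lemma word_surj y : exists v, word f v x0 = y.
Proof.
pose A := [set y | [exists v, word f v x0 == y]].
have : y \in orb f x0 by have /(trans_mapsP _ x0)[_ ->] := ft.
have /subsetP h : orb f x0 \subset A.
  apply: orb_min => [|i z]; first by rewrite inE; apply/existsP; exists 0%R; rewrite word0 perm1.
  rewrite !inE => /existsP[v /eqP <-]; apply/existsP; exists (v + delta_mx 0 i)%R.
  by rewrite wordD word_delta permM.
by move/h; rewrite inE => /existsP[v /eqP]; exists v.
Qed.

Definition word_stab : {set V} := [set v | word f v x0 == x0].

Lemma word_stab_group : group_set word_stab.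
Proof.
apply/group_setP; split; first by rewrite inE word0 perm1.
move=> u v; rewrite !inE => /eqP hu /eqP hv.
by rewrite wordD permM hu hv.
Qed.

Lemma word_stabP u v : (word f u x0 == word f v x0) = ((u - v)%R \in word_stab).
Proof.
by rewrite inE -{1}(subrK v u) (wordD (u - v)%R) permM (inj_eq perm_inj).
Qed.

(** 'Z_k ^ l is abelian with l generators, and the rank of abelian groups is
monotone. *)
Lemma word_stab_gen : exists w : {ffun 'I_l -> V}, word_stab = <<[set w i | i : 'I_l]>>.
Proof.
pose H := Group word_stab_group.
have abV (G : {group V}) : abelian G by apply: FinRing.zmod_abelian.
have genV : [set: V] = <<[set (delta_mx 0%R i : V) | i : 'I_l]>>.
  apply/eqP; rewrite eqEsubset subsetT andbT; apply/subsetP => v _.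
  rewrite (row_sum_delta v).
  apply: (big_ind (fun v : V => v \in <<[set (delta_mx 0%R i : V) | i : 'I_l]>>)).
  - exact: group1.
  - by move=> u1 u2; apply: groupM.
  move=> i _; rewrite -[v _ _]natr_Zp scaler_nat -FinRing.zmodXgE groupX //.
  by apply: mem_gen; apply/imsetP; exists i.
have mV : 'm([set: V]) <= l.
  rewrite genV; apply: leq_trans (grank_min _) _.
  by apply: leq_trans (leq_imset_card _ _) _; rewrite card_ord.
have mH : 'm(H) <= l.
  rewrite grank_abelian //; apply: leq_trans (rankS (subsetT _)) _.
  by rewrite -(grank_abelian (abV [set: V]%G)).
have [B genB cB] := grank_witness H.
exists [ffun i : 'I_l => nth 0%R (enum B) i]; rewrite -[LHS]genB.
apply/eqP; rewrite eqEsubset !gen_subG; apply/andP; split; apply/subsetP.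
  move=> v vB; have hv : index v (enum B) < l.
    by apply: leq_trans mH; rewrite -cB cardE index_mem mem_enum.
  apply: mem_gen; apply/imsetP; exists (Ordinal hv) => //.
  by rewrite ffunE /= nth_index ?mem_enum.
move=> _ /imsetP[i _ ->]; rewrite ffunE.
have [hi|hi] := ltnP i (size (enum B)); last by rewrite nth_default // group1.
by apply: mem_gen; rewrite -mem_enum mem_nth.
Qed.
End Fixed.

(** Both tuples act as 'Z_k ^ l does on the cosets of the common stabilizer, and the
conjugating permutation matches the two labellings of points by words. *)
Lemma word_stab_conj f g : f \in trans_maps l T -> g \in trans_maps l T ->
  word_stab f = word_stab g -> exists s : {perm T}, forall i, g i = f i ^ s.
Proof.
move=> ft gt fg.
have fgE u v : (word f u x0 == word f v x0) = (word g u x0 == word g v x0).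
  by rewrite !word_stabP // fg.
have hex y : exists v, word f v x0 == y by have [v <-] := word_surj ft y; exists v.
pose s y := word g (xchoose (hex y)) x0.
have sE v : s (word f v x0) = word g v x0.
  by apply/eqP; rewrite -fgE; apply/(xchooseP (hex (word f v x0))).
have s_inj : injective s.
  move=> y z; have [u <-] := word_surj ft y; have [v <-] := word_surj ft z.
  by rewrite !sE => /eqP; rewrite -fgE => /eqP.
exists (perm s_inj) => i; apply/permP => y.
rewrite -[y](permKV (perm s_inj)) permJ; move: (_ y) => {}y.
have [v <-] := word_surj ft y.
by rewrite !permE sE -{1}(word_delta g i) -{1}(word_delta f i) -!permM -!wordD // sE.
Qed.

(** A stabilizer is given by l generators, and the tuples sharing a stabilizer lie
in a single conjugacy class. *)
Lemma card_trans_le : #|trans_maps l T| <= #|V| ^ l * k`!.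
Proof.
pose Tr (w : {ffun 'I_l -> V}) :=
  [set f in trans_maps l T | word_stab f == <<[set w i | i : 'I_l]>>].
have cTr w : #|Tr w| <= k`!.
  have [->|[f]] := set_0Vmem (Tr w); first by rewrite cards0.
  rewrite [f \in _]in_set => /andP[ft /eqP sf].
  have <- : #|[set: {perm T}]| = k`!.
    have := card_perm [set: T]; rewrite (cardsT T) => <-.
    by apply: eq_card => s; rewrite !inE; apply/esym/subsetP => x; rewrite inE.
  apply: leq_trans (leq_imset_card (fun s => [ffun i => f i ^ s]) _).
  apply: subset_leq_card; apply/subsetP => g; rewrite [g \in _]in_set.
  move=> /andP[gt /eqP sg]; have [|s sE] := word_stab_conj ft gt; first by rewrite sf sg.
  by apply/imsetP; exists s => //; apply/ffunP => i; rewrite ffunE sE.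
have -> : (#|V| ^ l)%N = #|{: {ffun 'I_l -> V}}| by rewrite card_ffun card_ord.
rewrite -sum_nat_const; apply: leq_trans (leq_sum _ (fun w _ => cTr w)).
rewrite -sum1_card; under [leqRHS]eq_bigr do rewrite -sum1_card.
rewrite (exchange_big_dep (fun f => f \in trans_maps l T)) /=; last first.
  by move=> w f _; rewrite in_set => /andP[].
apply: leq_sum => f ft; have [w sw] := word_stab_gen ft.
by rewrite (bigD1 w) //= in_set ft sw eqxx.
Qed.
End Upper.

Lemma trans_weight_ge l k : 1 < l -> 0 < k -> (k%:R <= trans_weight l k)%R.
Proof.
case: k => // m l2 _; rewrite /trans_weight ler_pdivlMr ?ltr0n ?fact_gt0 //.
by rewrite -natrM ler_nat leq_mul2l fact_le_ntrans ?orbT.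
Qed.

Lemma trans_weight_le l k : (trans_weight l k <= (k.+1 ^ (l * l).+1)%:R)%R.
Proof.
case: k => [|m]; first by rewrite /trans_weight mul0n mul0r ler0n.
rewrite /trans_weight ler_pdivrMr ?ltr0n ?fact_gt0 // -natrM ler_nat.
have := card_trans_le l (ord0 : 'I_m.+1); rewrite !card_ord card_mx mul1n => h.
have hZ : #|'Z_m.+1| <= m.+2 by rewrite card_ord; case: (m).
rewrite expnS -mulnA leq_mul // (leq_trans h) // leq_mul2r -expnM.
by rewrite leq_exp2rW ?orbT.
Qed.

Lemma N_comm_ratio l n : N l n = comm_ratio l n.
Proof.
rewrite /N /comm_ratio card_Sn /ncomm.
have tup_inj : injective (fun f : {ffun 'I_l -> 'S_n} => [tuple f i | i < l]).
  move=> f g e; apply/ffunP => i.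
  by have := congr1 (fun u => tnth u i) e; rewrite !tnth_mktuple.
rewrite -(card_imset _ tup_inj); congr (#|pred_of_set _|%:R / _)%R.
apply/setP => u; apply/idP/imsetP => [|[f /comm_mapsP fc ->]].
  rewrite inE => /forallP uc; exists [ffun i => tnth u i].
    by apply/comm_mapsP => i j; rewrite !ffunE; apply/eqP; have /forallP := uc i; apply.
  by apply: eq_from_tnth => i; rewrite tnth_mktuple ffunE.
rewrite inE; apply/forallP => i; apply/forallP => j; rewrite !tnth_mktuple.
exact/eqP/fc.
Qed.

Theorem corollary1p6 (l : nat) (hl : 2 <= l) :
  exists n0 : nat, forall a b : nat, n0 <= a -> n0 <= b ->
    (N l (a + b) < N l a * N l b)%R.
Proof.
have [n0 hn0] := recursion_supermult (comm_ratio0 l) (ratio_recursion l)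
  (fun k => @trans_weight_ge l k hl) (trans_weight_le l).
by exists n0 => a b ha hb; rewrite !N_comm_ratio; apply: hn0.
Qed.
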